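(* Let $\mathbb{F}$ be a field of characteristic not $2$, let $n\geq 1$, and let $\mathcal{E}$ be a nilpotent evolution algebra over $\mathbb{F}$ of type $[1,n,1]$. Then $\mathcal{E}$ is isomorphic to an algebra $\mathcal{E}(\mathcal{U},b,u)$ for some triple $(\mathcal{U},b,u)$, where $\mathcal{U}$ is a nonzero finite-dimensional $\mathbb{F}$-vector space, $b:\mathcal{U}\times\mathcal{U}\to\mathbb{F}$ is a nondegenerate symmetric bilinear form and $0\neq u\in\mathcal{U}$. Moreover, for any two such triples $(\mathcal{U},b,u)$ and $(\mathcal{U}',b',u')$, the algebras $\mathcal{E}(\mathcal{U},b,u)$ and $\mathcal{E}(\mathcal{U}',b',u')$ are isomorphic if and only if there is a similarity $\psi:(\mathcal{U},b)\to(\mathcal{U}',b')$ such that $\psi(u)=u'$.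
   Context: An evolution algebra (finite-dimensional here) is an algebra $\mathcal{E}$ over $\mathbb{F}$ with a basis $\{e_1,\ldots,e_m\}$ (a natural basis) such that $e_ie_j=0$ for $i\neq j$; it is automatically commutative, and need not be associative. For an algebra $\mathcal{A}$, $\mathrm{ann}(\mathcal{A})=\{x\in\mathcal{A}: x\mathcal{A}=\mathcal{A}x=0\}$, $\mathrm{ann}^0(\mathcal{A})=0$, and $\mathrm{ann}^i(\mathcal{A})$ is defined by $\mathrm{ann}^i(\mathcal{A})/\mathrm{ann}^{i-1}(\mathcal{A})=\mathrm{ann}(\mathcal{A}/\mathrm{ann}^{i-1}(\mathcal{A}))$. With $\mathcal{A}^1=\mathcal{A}$ and $\mathcal{A}^{k+1}=\sum_{i=1}^k\mathcal{A}^i\mathcal{A}^{k+1-i}$, $\mathcal{A}$ is nilpotent if $\mathcal{A}^m=0$ for some $m$, equivalently $\mathrm{ann}^r(\mathcal{A})=\mathcal{A}$ for some $r$. The type of a finite-dimensional nilpotent algebra $\mathcal{A}$ is the sequence $[n_1,\ldots,n_r]$, where $r$ is the least natural number with $\mathrm{ann}^r(\mathcal{A})=\mathcal{A}$ and $n_i=\dim\mathrm{ann}^i(\mathcal{A})-\dim\mathrm{ann}^{i-1}(\mathcal{A})$. For a triple $(\mathcal{U},b,u)$ as in the claim, $\mathcal{E}(\mathcal{U},b,u)$ is the vector space $\mathbb{F}\times\mathcal{U}\times\mathbb{F}$ with multiplication $(\alpha,x,\beta)(\gamma,y,\delta)=(0,\alpha\gamma u,b(x,y))$. A similarity $\psi:(\mathcal{U},b)\to(\mathcal{U}',b')$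 is a linear isomorphism $\psi:\mathcal{U}\to\mathcal{U}'$ for which there is a nonzero scalar $\mu\in\mathbb{F}$ with $b'(\psi(x),\psi(y))=\mu b(x,y)$ for all $x,y\in\mathcal{U}$. *)

(* Defs.v *)
From HB Require Import structures.
From mathcomp Require Import all_boot all_order all_algebra.
From mathcomp Require Import sesquilinear.

Set Implicit Arguments.
Unset Strict Implicit.
Unset Printing Implicit Defensive.

Import GRing.Theory.
Local Open Scope ring_scope.

(* A finite-dimensional, not necessarily associative or unital, F-algebra is a
   vectType together with a bilinear multiplication on it. *)
Section Algebra.
Variables (F : fieldType) (A : vectType F) (mul : {bilinear A -> A -> A}).

Definition evolution_algebra : Prop :=
  exists (m : nat) (e : m.-tuple A),
    basis_of {:A} e /\
    forall i j : 'I_m, i != j -> mul (tnth e i) (tnth e j) = 0.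

(* The span of all products u v with u in U and v in V; see mulvP. *)
Definition mulv (U V : {vspace A}) : {vspace A} :=
  <<[seq mul u v | u <- vbasis U, v <- vbasis V]>>%VS.

Lemma mulvP (U V W : {vspace A}) :
  reflect (forall u v, u \in U -> v \in V -> mul u v \in W) (mulv U V <= W)%VS.
Proof.
apply: (iffP span_subvP) => [sW u v /coord_vbasis-> /coord_vbasis-> | sW w].
  rewrite linear_sumr; apply: memv_suml => j _.
  rewrite linear_sumlz; apply: memv_suml => i _.
  rewrite linearZr_LR linearZl_LR; do 2!apply: memvZ.
  by apply/sW/allpairsP; exists ((vbasis U)`_i, (vbasis V)`_j);
     rewrite /= !mem_nth ?size_tuple.
by case/allpairsP=> -[u v] /= [uU vV ->]; apply: sW; apply: vbasis_mem.
Qed.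

(* The list [:: A^1; ...; A^k.+1]. *)
Fixpoint alg_powers (k : nat) : seq {vspace A} :=
  if k is k'.+1 then
    let s := alg_powers k' in
    rcons s (\sum_(i < size s) mulv (nth 0 s i) (nth 0 s (size s - i.+1)))%VS
  else [:: {:A}%VS].

(* A^k for k >= 1; alg_power 0 is a junk value, equal to A^1. *)
Definition alg_power (k : nat) : {vspace A} :=
  nth 0%VS (alg_powers k.-1) k.-1.

Lemma size_alg_powers k : size (alg_powers k) = k.+1.
Proof. by elim: k => //= k IHk; rewrite size_rcons IHk. Qed.

Lemma nth_alg_powers k i : (i <= k)%N -> nth 0%VS (alg_powers k) i = alg_power i.+1.
Proof.
elim: k => [|k IHk]; first by case: i.
rewrite leq_eqVlt => /predU1P[-> //|lt_ik].
by rewrite /= nth_rcons size_alg_powers lt_ik IHk.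
Qed.

Lemma alg_power1 : alg_power 1 = {:A}%VS. Proof. by []. Qed.

Lemma alg_powerS k : (0 < k)%N ->
  alg_power k.+1 =
    (\sum_(1 <= i < k.+1) mulv (alg_power i) (alg_power (k.+1 - i)))%VS.
Proof.
case: k => // k _.
rewrite {1}/alg_power /= nth_rcons size_alg_powers ltnn eqxx.
rewrite big_add1 /= big_mkord; apply: eq_bigr => i _.
by rewrite !nth_alg_powers ?leq_ord // ?subSS ?leq_subr // subSn ?leq_ord.
Qed.

Definition nilpotent_algebra : Prop :=
  exists2 m : nat, (0 < m)%N & alg_power m = 0%VS.

(* The subspace of all x with x A and A x contained in I; see annmodP.  When I
   is an ideal, it is the preimage of ann(A/I) under A -> A/I; see
   mem_annmod_quotient. *)
Definition annmod (I : {vspace A}) : {vspace A} :=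
  (\bigcap_(i < \dim {:A})
     (linfun (mul (vbasis {:A})`_i) @^-1: I
      :&: linfun (applyr mul (vbasis {:A})`_i) @^-1: I))%VS.

Lemma annmodP (I : {vspace A}) x :
  reflect (forall y, mul x y \in I /\ mul y x \in I) (x \in annmod I).
Proof.
rewrite memvE; apply: (iffP subv_bigcapP) => [xI y | xI i _]; last first.
  by rewrite -memvE memv_cap -!memv_preim !lfunE /= !(proj1 (xI _)) (proj2 (xI _)).
have {}xI (i : 'I_(\dim {:A})) :
    mul x (vbasis {:A})`_i \in I /\ mul (vbasis {:A})`_i x \in I.
  have := xI i isT; rewrite -memvE memv_cap -!memv_preim !lfunE /=.
  by case/andP.
rewrite (coord_vbasis (memvf y)) linear_sumr linear_sumlz.
split; apply: memv_suml => i _; case: (xI i) => xIl xIr.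
  by rewrite linearZr_LR; apply: memvZ.
by rewrite linearZl_LR; apply: memvZ.
Qed.

Definition ann : {vspace A} := annmod 0.

Lemma annP x : reflect (forall y, mul x y = 0 /\ mul y x = 0) (x \in ann).
Proof.
apply: (iffP (annmodP _ _)) => xA y; case: (xA y); rewrite ?memv0.
  by move=> /eqP-> /eqP->.
by move=> -> ->.
Qed.

(* ann^i(A). *)
Definition ann_series (i : nat) : {vspace A} := iter i annmod 0%VS.

Lemma ann_series_sub i : (ann_series i <= ann_series i.+1)%VS.
Proof.
elim: i => [|i IHi]; first exact: sub0v.
apply/subvP=> x /annmodP xA; apply/annmodP=> y.
by have [xy yx] := xA y; split; apply: (subvP IHi).
Qed.

(* "A has type s", where s = [n_1, ..., n_r]; the list is indexed from 0.  By
   ann_series_sub the natural-number subtraction is not truncated. *)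
Definition has_type (s : seq nat) : Prop :=
  [/\ ann_series (size s) = {:A}%VS,
      forall k, (k < size s)%N -> ann_series k <> {:A}%VS
    & s = [seq (\dim (ann_series i.+1) - \dim (ann_series i))%N
            | i <- iota 0 (size s)]].

End Algebra.

Definition algebra_isomorphic (F : fieldType) (A B : vectType F)
    (mulA : {bilinear A -> A -> A}) (mulB : {bilinear B -> B -> B}) : Prop :=
  exists f : {linear A -> B},
    bijective f /\ forall x y, f (mulA x y) = mulB (f x) (f y).

Lemma mem_annmod_quotient (F : fieldType) (A B : vectType F)
    (mulA : {bilinear A -> A -> A}) (mulB : {bilinear B -> B -> B})
    (p : 'Hom(A, B)) :
    limg p = {:B}%VS -> (forall x y, p (mulA x y) = mulB (p x) (p y)) ->
  forall x, (x \in annmod mulA (lker p)) = (p x \in ann mulB).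
Proof.
move=> p_onto pM x; apply/annmodP/annP=> xA y.
  have /memv_imgP[z _ ->]: y \in limg p by rewrite p_onto memvf.
  by have [] := xA z; rewrite !memv_ker !pM => /eqP-> /eqP->.
by have [xy yx] := xA (p y); rewrite !memv_ker !pM xy yx eqxx.
Qed.

Section EvolutionOfForm.
Variables (F : fieldType) (U : vectType F) (b : {symmetric U}) (u : U).

Definition evo_space : vectType F := (F^o * U * F^o)%type.

Definition evo_mul (x y : evo_space) : evo_space :=
  (0, (x.1.1 * y.1.1 : F) *: u, b x.1.2 y.1.2).

Fact evo_mul_zmodl y : zmod_morphism (evo_mul ^~ y).
Proof.
move=> x x'; rewrite /evo_mul /= linearBl mulrBl scalerBl.
by congr (_, _, _); rewrite /= subr0.
Qed.

Fact evo_mul_zmodr x : zmod_morphism (evo_mul x).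
Proof.
move=> y y'; rewrite /evo_mul /= linearBr mulrBr scalerBl.
by congr (_, _, _); rewrite /= subr0.
Qed.

Fact evo_mul_scalel y : scalable_for *:%R (evo_mul ^~ y).
Proof.
move=> a x; rewrite /evo_mul /= linearZl_LR.
by congr (_, _, _); rewrite /= ?scaler0 // scalerA mulrA.
Qed.

Fact evo_mul_scaler x : scalable_for *:%R (evo_mul x).
Proof.
move=> a y; rewrite /evo_mul /= linearZr_LR.
by congr (_, _, _); rewrite /= ?scaler0 // scalerA mulrCA.
Qed.

HB.instance Definition _ := isBilinear.Build F evo_space evo_space evo_space
  *:%R *:%R evo_mul evo_mul_zmodl evo_mul_zmodr evo_mul_scalel evo_mul_scaler.

Definition admissible_triple : Prop :=
  [/\ {:U}%VS != 0%VS, nondegenerate b & u != 0].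

End EvolutionOfForm.

Definition similarity (F : fieldType) (U U' : vectType F)
    (b : {symmetric U}) (b' : {symmetric U'}) (psi : {linear U -> U'}) : Prop :=
  bijective psi /\
  exists2 mu : F, mu != 0 & forall x y, b' (psi x) (psi y) = mu * b x y.

(* Main.v *)
(* Part 1: some natural basis vector t lies outside ann^2(E), and t E is the
   line of a = t t.  Then a is in ann^2(E) but not in ann(E), since otherwise t
   would be in ann^2(E); hence t kills ann^2(E).  Writing ann(E) = F z and
   choosing a complement W of ann(E) in ann^2(E) that contains a, we get
   E = F t + W + F z, and products of elements of W, read as multiples of z,
   give the form.
   Part 2: 0 x 0 x F and 0 x U x F are ann and ann^2 of E(U,b,u), so an
   isomorphism f induces a similarity phi : U -> U'.  If a is the first
   coordinate of f(1,0,0), comparing squares gives phi(u) = a^2 u', and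
   a^-2 phi is the required similarity. *)
Require Import Defs.
From HB Require Import structures.
From mathcomp Require Import all_boot all_order all_algebra.
From mathcomp Require Import sesquilinear.

Set Implicit Arguments.
Unset Strict Implicit.
Unset Printing Implicit Defensive.

Import GRing.Theory.
Local Open Scope ring_scope.

Lemma nondegenerate_pairing (F : fieldType) (U : vectType F) (b : {symmetric U}) :
  reflect (forall x, (forall y, b x y = 0) -> x = 0) (nondegenerate b).
Proof.
rewrite /nondegenerate -subv0; apply: (iffP subvP) => [b0 x xb | b0 x].
  by apply/eqP; rewrite -memv0 b0 //; apply/mem_orthovP => y _.
by move/mem_orthovP=> xb; rewrite memv0; apply/eqP/b0 => y; rewrite xb ?memvf.
Qed.

(** The map runs from [B] back to [A] because a map out of a model such as E(U,b,u) is given by a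
    formula; its inverse is the isomorphism sought. *)
Lemma isomorphic_of_injective_surjective (F : fieldType) (A B : vectType F)
    (mulA : {bilinear A -> A -> A}) (mulB : {bilinear B -> B -> B})
    (g : {linear B -> A}) :
    (forall x, g x = 0 -> x = 0) -> (forall y, exists x, g x = y) ->
    (forall x y, g (mulB x y) = mulA (g x) (g y)) ->
  algebra_isomorphic mulA mulB.
Proof.
move=> g0 g_onto gM; pose h := linfun g.
have hE x : h x = g x by rewrite lfunE.
have h0 : lker h == 0%VS.
  by rewrite -subv0; apply/subvP=> x; rewrite memv_ker hE memv0 => /eqP/g0->.
have hK : cancel h h^-1%VF by apply: lker0_lfunK.
have hVK : cancel h^-1%VF h.
  by move=> y; have [x <-] := g_onto y; rewrite -hE hK.
exists h^-1%VF; split=> [|x y]; first by exists h.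
by rewrite -[RHS]hK hE gM -!hE !hVK.
Qed.

(** * The first two annihilators of E(U,b,u) *)

Section EvolutionOfFormTheory.
Variables (F : fieldType) (U : vectType F) (b : {symmetric U}) (u : U).
Hypothesis adm : admissible_triple b u.
Local Notation E := (evo_space U).
Local Notation mul := (evo_mul b u).

(** Multiplying by (1,0,0) detects the first coordinate because [u] is nonzero; multiplying by the
    (0,y,0) detects the second by nondegeneracy. *)
Lemma evo_annP (p : E) :
  reflect (forall q, mul p q = 0) ((p.1.1 == 0) && (p.1.2 == 0)).
Proof.
have [_ /nondegenerate_pairing bN u0] := adm.
apply: (iffP andP) => [[/eqP p1 /eqP p2] q | p0].
  by rewrite /evo_mul p1 p2 linear0l mul0r scale0r.
split; apply/eqP.
  have := p0 (1 : F, 0, 0); rewrite /evo_mul /= mulr1 => -[/eqP + _].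
  by rewrite scaler_eq0 (negPf u0) orbF => /eqP.
by apply: bN => y; have := p0 (0, y, 0) => -[].
Qed.

(** Multiplying by (1,0,0) moves the first coordinate, times [u], to the middle, where the criterion
    for ann sees it. *)
Lemma evo_ann2P (p : E) :
  reflect (forall q r, mul (mul p q) r = 0) (p.1.1 == 0).
Proof.
have [_ _ u0] := adm.
apply: (iffP eqP) => [p1 q | p0].
  by apply/evo_annP; rewrite /evo_mul /= p1 mul0r scale0r !eqxx.
have /evo_annP/andP[_] := p0 (1 : F, 0, 0).
by rewrite /evo_mul /= mulr1 scaler_eq0 (negPf u0) orbF => /eqP.
Qed.

End EvolutionOfFormTheory.

(** * From isomorphisms to similarities *)

Section Isomorphism.
Variables (F : fieldType) (U U' : vectType F).
Variables (b : {symmetric U}) (b' : {symmetric U'}) (u : U) (u' : U').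
Hypotheses (adm : admissible_triple b u) (adm' : admissible_triple b' u').
Variable f : {linear evo_space U -> evo_space U'}.
Hypothesis fM : forall x y, f (evo_mul b u x y) = evo_mul b' u' (f x) (f y).
Variable g : evo_space U' -> evo_space U.
Hypotheses (fK : cancel f g) (gK : cancel g f).

(** Membership in ann is a statement about products alone, so the bijection [f] carries it over in
    both directions. *)
Lemma evo_iso_ann p :
  (p.1.1 == 0) && (p.1.2 == 0) = ((f p).1.1 == 0) && ((f p).1.2 == 0).
Proof.
apply/(evo_annP adm p)/(evo_annP adm' (f p)) => p0 q.
  by rewrite -[q]gK -!fM p0 linear0.
by apply: (can_inj fK); rewrite !fM p0 linear0.
Qed.

Lemma evo_iso_ann2 p : (p.1.1 == 0) = ((f p).1.1 == 0).
Proof.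
apply/(evo_ann2P adm p)/(evo_ann2P adm' (f p)) => p0 q r.
  by rewrite -[q]gK -[r]gK -!fM p0 linear0.
by apply: (can_inj fK); rewrite !fM p0 linear0.
Qed.

(** The map induced by [f] on ann^2/ann, read in the middle coordinate. *)
Definition evo_iso_mid (x : U) : U' := (f (0, x, 0)).1.2.

Fact evo_iso_mid_linear : linear evo_iso_mid.
Proof.
move=> a x y; rewrite /evo_iso_mid.
rewrite (_ : (0, a *: x + y, 0) = a *: (0, x, 0) + (0, y, 0) :> evo_space U).
  by rewrite linearP.
by congr (_, _, _); rewrite /= scaler0 addr0.
Qed.
HB.instance Definition _ :=
  GRing.isLinear.Build F U U' *:%R evo_iso_mid evo_iso_mid_linear.

Lemma evo_iso_mulr : exists2 mu : F, mu != 0 &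
  forall c : F, f (0, 0, c) = (0, 0, mu * c).
Proof.
have fc c : f (0, 0, c) = (0, 0, (f (0, 0, 1)).2 * c).
  have -> : (0, 0, c) = c *: (0, 0, 1) :> evo_space U.
    by congr (_, _, _); rewrite /= ?scaler0 // -[RHS]/(c * 1) mulr1.
  have := evo_iso_ann (0, 0, 1); rewrite /= !eqxx linearZ.
  case: (f _) => [[x y] z] /= /esym/andP[/eqP-> /eqP->].
  by congr (_, _, _); rewrite /= ?scaler0 // mulrC.
exists (f (0, 0, 1)).2 => //; apply/eqP => mu0.
have : f (0, 0, 1) = f 0 by rewrite fc mu0 mul0r linear0.
by move/(can_inj fK) => [/eqP]; rewrite oner_eq0.
Qed.

(** The first coordinate vanishes because [f] preserves ann^2; [c] has no effect because it only
    adds an element of ann to the image. *)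
Lemma evo_iso_ann2E x c : (f (0, x, c)).1 = (0, evo_iso_mid x).
Proof.
have [mu _ fc] := evo_iso_mulr.
have -> : (0, x, c) = (0, x, 0) + (0, 0, c) :> evo_space U.
  by congr (_, _, _); rewrite /= ?add0r ?addr0.
rewrite linearD fc /= /evo_iso_mid.
have := evo_iso_ann2 (0, x, 0); rewrite /= eqxx.
case: (f _) => [[y z] w] /= /esym/eqP->.
by congr (_, _); rewrite /= addr0.
Qed.

Lemma evo_iso_mid_bij : bijective evo_iso_mid.
Proof.
have mid_inj : injective evo_iso_mid.
  apply: raddf_inj => x mid0; have := evo_iso_ann (0, x, 0).
  by rewrite evo_iso_ann2E /= mid0 !eqxx /= => /eqP.
(* The preimage of (0,y,0) lies in ann^2, so it has the form (0,x,c), and [evo_iso_mid] sends this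
   [x] to [y]. *)
have midK : cancel (fun y => (g (0, y, 0)).1.2) evo_iso_mid.
  move=> y; have := evo_iso_ann2 (g (0, y, 0)); rewrite gK eqxx.
  case Dg: (g _) => [[a x] c] /= /eqP a0; rewrite a0 in Dg.
  by have := evo_iso_ann2E x c; rewrite -Dg gK => -[].
exists (fun y => (g (0, y, 0)).1.2) => // x.
by apply: mid_inj; rewrite midK.
Qed.

(** Both sides are the last coordinate of the image of (0,x,0)(0,y,0) = (0,0,b(x,y)), and [mu] is
    the scalar by which [f] acts on ann. *)
Lemma evo_iso_mid_pairing : exists2 mu : F, mu != 0 &
  forall x y, b' (evo_iso_mid x) (evo_iso_mid y) = mu * b x y.
Proof.
have [mu mu0 fc] := evo_iso_mulr; exists mu => // x y.
have := fM (0, x, 0) (0, y, 0); rewrite {1}/evo_mul /= mul0r scale0r fc.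
by rewrite /evo_mul => -[_ ->].
Qed.

Lemma evo_iso_mid_square : exists2 a : F, a != 0 & evo_iso_mid u = (a ^+ 2) *: u'.
Proof.
exists (f (1, 0, 0)).1.1.
  (* The scalar is nonzero because (1,0,0) lies outside ann^2. *)
  by have := evo_iso_ann2 (1 : F, 0, 0); rewrite oner_eq0 => <-.
have := congr1 fst (fM (1, 0, 0) (1, 0, 0)).
rewrite {1}/evo_mul /= mulr1 scale1r linear0l evo_iso_ann2E => -[->].
by rewrite expr2.
Qed.

Lemma similarity_of_evo_iso :
  exists psi : {linear U -> U'}, similarity b b' psi /\ psi u = u'.
Proof.
have [mu mu0 mid_b] := evo_iso_mid_pairing.
have [a a0 mid_u] := evo_iso_mid_square.
have [h midK hK] := evo_iso_mid_bij.
have a20 : a ^+ 2 != 0 by rewrite expf_neq0.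
exists ((a ^- 2) \*: evo_iso_mid); split; last first.
  by rewrite /= mid_u scalerA mulVf // scale1r.
split; first exists (fun y => h (a ^+ 2 *: y)) => x /=.
- by rewrite scalerA mulfV // scale1r midK.
- by rewrite hK scalerA mulVf // scale1r.
(* Each of the two arguments of [b'] contributes one factor a^-2. *)
exists (a ^- 2 * a ^- 2 * mu) => [|x y]; first by rewrite !mulf_neq0 ?invr_eq0.
by rewrite /= linearZl_LR linearZr_LR /= mid_b !mulrA.
Qed.

End Isomorphism.

(** * From similarities to isomorphisms *)

Lemma evo_iso_of_similarity (F : fieldType) (U U' : vectType F)
    (b : {symmetric U}) (b' : {symmetric U'}) (u : U) (psi : {linear U -> U'}) :
  similarity b b' psi -> algebra_isomorphic (evo_mul b u) (evo_mul b' (psi u)).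
Proof.
case=> [[h psiK hK] [mu mu0 psi_b]].
(* Scaling the last coordinate by [mu] absorbs the similarity factor. *)
pose f (p : evo_space U) : evo_space U' := (p.1.1, psi p.1.2, mu * p.2).
have f_lin : linear f.
  by move=> c p q; rewrite /f /= linearP mulrDr; congr (_, _, _ + _); rewrite mulrCA.
pose fL : {linear evo_space U -> evo_space U'} := HB.pack f
  (GRing.isLinear.Build F (evo_space U) (evo_space U') *:%R f f_lin).
exists fL; split=> [|p q] /=.
  exists (fun q : evo_space U' => (q.1.1, h q.1.2, mu^-1 * q.2)).
  - by case=> [[x y] z]; rewrite /f /= psiK mulKf.
  - by case=> [[x y] z]; rewrite /f /= hK mulVKf.
by rewrite /f /evo_mul /= linearZ psi_b.
Qed.

(** * Products in a natural basis *)

Lemma natural_basis_mul (F : fieldType) (A : vectType F)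
    (mul : {bilinear A -> A -> A}) (m : nat) (e : m.-tuple A) :
    basis_of {:A} e -> (forall i j, i != j -> mul (tnth e i) (tnth e j) = 0) ->
  forall x y, mul x y =
    \sum_i (coord e i x * coord e i y) *: mul (tnth e i) (tnth e i).
Proof.
move=> e_basis e_orth x y.
rewrite {1}(coord_basis e_basis (memvf x)) {1}(coord_basis e_basis (memvf y)).
rewrite linear_sumlz; apply: eq_bigr => i _.
rewrite linear_sumr (bigD1 i) //= big1 => [|j ne_ji]; rewrite -!tnth_nth.
  by rewrite addr0 linearZl_LR linearZr_LR /= scalerA.
by rewrite linearZl_LR linearZr_LR /= e_orth 1?eq_sym // !scaler0.
Qed.

Lemma evolution_algebraC (F : fieldType) (A : vectType F)
    (mul : {bilinear A -> A -> A}) :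
  evolution_algebra mul -> forall x y, mul x y = mul y x.
Proof.
case=> m [e [e_basis /(natural_basis_mul e_basis) mulE]] x y.
by rewrite !mulE; apply: eq_bigr => i _; rewrite mulrC.
Qed.

(** A natural basis cannot lie inside a proper subspace, and multiplication by one of its vectors
    sees only the matching coordinate. *)
Lemma evolution_generator (F : fieldType) (A : vectType F)
    (mul : {bilinear A -> A -> A}) (V : {vspace A}) :
    evolution_algebra mul -> V <> {:A}%VS ->
  exists2 t, t \notin V & forall y, exists c, mul t y = c *: mul t t.
Proof.
case=> m [e [e_basis e_orth]] V_proper.
case: (pickP (fun i => tnth e i \notin V)) => [k eV | eV]; last first.
  case: V_proper; apply/eqP; rewrite eqEsubv subvf /= -(span_basis e_basis).
  by apply/span_subvP=> _ /tnthP[i ->]; have /negbFE := eV i.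
exists (tnth e k) => // y; exists (coord e k y).
rewrite (natural_basis_mul e_basis e_orth) (bigD1 k) //= big1 => [|i ne_ik].
  by rewrite addr0 (tnth_nth 0) coord_free ?(basis_free e_basis) // eqxx mul1r.
rewrite (tnth_nth 0) coord_free ?(basis_free e_basis) //.
by rewrite eq_sym (negPf ne_ik) mul0r scale0r.
Qed.

Lemma capv_vline (F : fieldType) (A : vectType F) (v : A) (V : {vspace A}) :
  v \notin V -> (<[v]> :&: V = 0)%VS.
Proof.
move=> vV; apply/eqP; rewrite -subv0; apply/subvP=> x /memv_capP[/vlineP[c ->]].
have [-> _|c0 cvV] := eqVneq c 0; first by rewrite scale0r mem0v.
by case/negP: vV; rewrite -[v](scalerK c0) memvZ.
Qed.

(** * Decomposition of an evolution algebra of type [1,n,1] *)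

Lemma evolution_type_1n1 (F : fieldType) (A : vectType F)
    (mul : {bilinear A -> A -> A}) (n : nat) :
    evolution_algebra mul -> has_type mul [:: 1%N; n; 1%N] ->
  exists (U : vectType F) (b : {symmetric U}) (u : U),
    admissible_triple b u /\ algebra_isomorphic mul (evo_mul b u).
Proof.
move=> evoA [A3' A_proper [d1' _ d3']].
have mulC := evolution_algebraC evoA.
pose N1 := ann_series mul 1; pose N2 := ann_series mul 2.
have d1 : \dim N1 = 1%N by rewrite [RHS]d1' /= dimv0 subn0.
have A3 : ann_series mul 3 = fullv := A3'.
have d3 : (\dim {:A} - \dim N2 = 1)%N by rewrite -A3 -d3'.
have {A3 A3' d1' d3'} mulN2 x y : mul x y \in N2.
  have : x \in ann_series mul 3 by rewrite A3 memvf.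
  by case/annmodP/(_ y).
have N12 : (N1 <= N2)%VS := ann_series_sub mul 1.
have N1P x : reflect (forall y, mul x y = 0 /\ mul y x = 0) (x \in N1).
  exact: annP.
have N2P x y : x \in N2 -> mul x y \in N1 by case/annmodP/(_ y).
have [t tN2 tA] := evolution_generator evoA (A_proper 2 isT).
set a := mul t t in tA.
have aN1 : a \notin N1.
  apply: contra tN2 => aN1; apply/annmodP=> y; rewrite (mulC y).
  by have [c ->] := tA y; split; apply: memvZ.
have tN2_0 y : y \in N2 -> mul t y = 0.
  move=> yN2; have [c tyE] := tA y; rewrite tyE.
  (* For nonzero [c], [a] would be a multiple of [mul t y], which lies in [N1]. *)
  have [->|c0] := eqVneq c 0; first by rewrite scale0r.
  case/negP: aN1; rewrite -[a](scalerK c0) -tyE memvZ // mulC.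
  exact: N2P.
pose z := vpick N1.
have z0 : z != 0 by rewrite vpick0 -dimv_eq0 d1.
have N1z : N1 = <[z]>%VS.
  by apply/esym/eqP; rewrite eqEdim -memvE memv_pick dim_vline z0 d1.
have zN1 : z \in N1 by rewrite memv_pick.
(* A complement of [<[a]> + N1] in [N2], enlarged by [a], is a complement of [N1] that contains
   [a]. *)
pose W := (<[a]> + (N2 :\: (<[a]> + N1)))%VS.
have aW : a \in W by rewrite memvE addvSl.
have aN2 : (<[a]> <= N2)%VS by rewrite -memvE mulN2.
have WN2 : (W <= N2)%VS by rewrite subv_add aN2 diffvSl.
have W_N1 : (W + N1)%VS = N2.
  rewrite /W [(<[a]> + _)%VS]addvC -addvA addv_diff.
  by apply/addv_idPl; rewrite subv_add aN2.
have W_cap_N1 : (W :&: N1 = 0)%VS.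
  apply/eqP; rewrite -subv0; apply/subvP=> w /memv_capP[].
  case/memv_addP=> v va [d dN2 ->] wN1.
  have d0 : d = 0.
    apply/eqP; rewrite -memv0 -(capv_diff N2 (<[a]> + N1)%VS) memv_cap dN2 /=.
    by rewrite -(addKr v d) memv_add // memvN.
  by rewrite d0 addr0 in wN1 *; rewrite -(capv_vline aN1) memv_cap va.
have t_N2 : (<[t]> + N2)%VS = fullv.
  apply/eqP; rewrite eqEdim subvf dimv_disjoint_sum ?capv_vline // dim_vline.
  rewrite addnC -leq_subLR d3 lt0b.
  by apply: contraNneq tN2 => ->; apply: mem0v.
(* This is the coefficient of [z] on [N1] only, but it is linear on all of [A], so [f] below is
   bilinear without side conditions. *)
pose zc (v : A) : F := coord [tuple z] ord0 v.
have zcK v : v \in N1 -> zc v *: z = v.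
  rewrite N1z -span_seq1 => /(@coord_span _ _ _ [tuple z]) {2}->.
  by rewrite big_ord1.
pose f (x y : subvs_of W) : F := zc (mul (vsval x) (vsval y)).
have fl y : linear_for *%R (f^~ y).
  by move=> c x x'; rewrite /f /zc /= linearPl linearP.
(* Symmetry, written as the Hermitian law with sign +1 and trivial conjugation. *)
have fC x y : f x y = (-1) ^+ false * idfun (f y x).
  by rewrite expr0 mul1r /f mulC.
have fr x : linear_for (idfun \; *%R) (f x).
  by move=> c y y'; rewrite /f /zc /= linearPr linearP.
pose b : {symmetric subvs_of W} := HB.pack f
  (bilinear_isBilinear.Build F (subvs_of W) (subvs_of W) F *%R (idfun \; *%R)
     f (fl, fr))
  (isHermitianSesquilinear.Build F (subvs_of W) false idfun f fC).
have bE x y : b x y *: z = mul (vsval x) (vsval y).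
  by apply/zcK/N2P/(subvP WN2)/subvsP.
pose g (p : evo_space (subvs_of W)) : A :=
  p.1.1 *: t + vsval p.1.2 + p.2 *: z.
have g_lin : linear g.
  move=> c p q; rewrite /g /= !scalerDl !scalerDr -!scalerA.
  by rewrite [RHS]addrACA; congr (_ + _); apply: addrACA.
have g0 (c d : F) (x : subvs_of W) :
    c *: t + vsval x + d *: z = 0 -> [/\ c = 0, x = 0 & d = 0].
  move=> sum0.
  have xdN2 : vsval x + d *: z \in N2.
    apply: memvD; first exact/(subvP WN2)/subvsP.
    by apply: memvZ; apply: (subvP N12).
  (* The vector lies in both [<[t]>] and [N2], which meet in 0. *)
  have ct0 : c *: t = 0.
    apply/eqP; rewrite -memv0 -(capv_vline tN2) memv_cap.
    rewrite memvZ ?memv_line //= -memvN.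
    suff -> : - (c *: t) = vsval x + d *: z by [].
    by apply/eqP; rewrite eq_sym -addr_eq0 addrC addrA sum0.
  rewrite ct0 add0r in sum0.
  have x0 : vsval x = 0.
    apply/eqP; rewrite -memv0 -W_cap_N1 memv_cap subvsP /=.
    have /eqP-> : vsval x == - (d *: z) by rewrite -addr_eq0 sum0.
    by rewrite memvN memvZ.
  have /eqP := sum0; rewrite x0 add0r scaler_eq0 (negPf z0) orbF => /eqP d0.
  have t0 : t != 0 by apply: contraNneq tN2 => ->; apply: mem0v.
  have /eqP := ct0; rewrite scaler_eq0 (negPf t0) orbF => /eqP c0.
  by split=> //; apply: val_inj.
pose gL : {linear evo_space (subvs_of W) -> A} := HB.pack g
  (GRing.isLinear.Build F (evo_space (subvs_of W)) A *:%R g g_lin).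
exists (subvs_of W), b, (vsproj W a); split.
  have u0 : vsproj W a != 0.
    apply: contra aN1 => /eqP/(congr1 vsval); rewrite vsprojK // => ->.
    exact: mem0v.
  split=> //.
    by apply: contra u0 => /eqP U0; rewrite -memv0 -U0 memvf.
  (* A vector of the radical kills [W], and as an element of [N2] it also kills [t] and [N1]; hence
     it lies in the intersection of [W] and [N1]. *)
  apply/nondegenerate_pairing => x xb; apply: val_inj.
  apply/eqP; rewrite /= -memv0 -W_cap_N1 memv_cap subvsP /=.
  apply/N1P=> y; rewrite (mulC y).
  suff : mul (vsval x) y = 0 by [].
  have : y \in (<[t]> + (W + N1))%VS by rewrite W_N1 t_N2 memvf.
  case/memv_addP=> _ /vlineP[c ->] [_ /memv_addP[w wW [v /N1P vN1 ->]] ->].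
  rewrite !linearDr linearZr_LR /= mulC tN2_0; last exact/(subvP WN2)/subvsP.
  by rewrite scaler0 add0r -(vsprojK wW) -bE xb scale0r (proj2 (vN1 _)) addr0.
apply: (@isomorphic_of_injective_surjective _ _ _ _ _ gL) => /=.
- by case=> [[c x] d]; rewrite /g /= => /g0[-> -> ->].
- move=> y; have : y \in (<[t]> + (W + N1))%VS by rewrite W_N1 t_N2 memvf.
  case/memv_addP=> _ /vlineP[c ->] [_ /memv_addP[w wW [v vN1 ->]] ->].
  by exists (c, vsproj W w, zc v); rewrite /g /= vsprojK // zcK // addrA.
- case=> [[c x] d] [[c' x'] d']; rewrite /g /evo_mul /= scale0r add0r.
  have zmul v : mul z v = 0 by have /N1P/(_ v)[] := zN1.
  have mulz v : mul v z = 0 by have /N1P/(_ v)[] := zN1.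
  have tx (w : subvs_of W) : mul t (vsval w) = 0.
    exact/tN2_0/(subvP WN2)/subvsP.
  (* Of the nine products only those of [t] with [t] and of [W] with [W] survive. *)
  rewrite !linearDl !linearDr !linearZl_LR !linearZr_LR /= !zmul !mulz !tx.
  rewrite (mulC (vsval x) t) tx !scaler0 !addr0 add0r.
  by rewrite vsprojK // bE scalerA.
Qed.

Theorem theorem4p11 (F : fieldType) (charF : 2%N \notin [pchar F]) :
  (forall (n : nat) (E : vectType F) (mul : {bilinear E -> E -> E}),
      (1 <= n)%N ->
      evolution_algebra mul ->
      nilpotent_algebra mul ->
      has_type mul [:: 1%N; n; 1%N] ->
      exists (U : vectType F) (b : {symmetric U}) (u : U),
        admissible_triple b u /\ algebra_isomorphic mul (evo_mul b u))
  /\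
  (forall (U U' : vectType F) (b : {symmetric U}) (b' : {symmetric U'})
          (u : U) (u' : U'),
      admissible_triple b u ->
      admissible_triple b' u' ->
      (algebra_isomorphic (evo_mul b u) (evo_mul b' u') <->
       exists psi : {linear U -> U'}, similarity b b' psi /\ psi u = u')).
Proof.
split=> [n E mul _ evoE _ typeE | U U' b b' u u' adm adm'].
  exact: evolution_type_1n1 evoE typeE.
split=> [[f [[g fK gK] fM]] | [psi [psi_sim <-]]].
  exact: similarity_of_evo_iso adm adm' _ fM _ fK gK.
exact: evo_iso_of_similarity.
Qed.
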